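(* Let $(X,r)$ be a relation in an elementary topos $\mathcal E$. Then for every generalized element $\langle a,s\rangle\colon W\to X\times PX$, $$W\Vdash a\in_X\mathsf{int}(s)\quad\text{if, and only if,}\quad W\Vdash\forall y\,\big((a\le_r y)\Rightarrow_\Omega(y\in_X s)\big),$$ where $y$ is a variable of type $X$.
   Context: Topos notation. $\top\colon 1\to\Omega$ is the subobject classifier, $\top_W\colon W\to 1\to\Omega$. $PX$ is the power object of $X$ with membership morphism $\in_X\colon X\times PX\to\Omega$; each $f\colon X\times Y\to\Omega$ has a unique transpose $\hat f\colon Y\to PX$ with $\in_X\circ(1\times\hat f)=f$. For $\langle x,s\rangle\colon W\to X\times PX$ write $x\in_X s$ for $\in_X\circ\langle x,s\rangle\colon W\to\Omega$. For $f\colon A\to B$, the inverse image $Pf\colon PB\to PA$ is the transpose of $\in_B\circ(f\times 1)\colon A\times PB\to\Omega$. Each $PX$ is an internal Heyting algebra with order the equalizer of meet and first projection. $\Rightarrow_\Omega$ is the Heyting implication on $\Omega$. Relations. A relation $(X,r)$ is a monomorphism $r\colon R\rightarrowtail X\times X$ (not assumed reflexive or transitive) with classifying morphism $\le_r\colon X\times X\to\Omega$; $r^\dagger$ is $r$ with the factors interchanged. $\uparrow\colon X\to PX$ is the transpose of the classifying morphism of $r^\dagger$, so $(a\in_X\uparrow b)=(b\le_r a)$. $\downarrow\colon PX\to P^2X$ is the transpose of the classifying morphism of the order on $PX$, so $(u\in_{PX}\downarrow s)=(u\le s)$. The interior operator is $\mathsf{int}:=P(\uparrow)\circ\downarrow\colon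 PX\to P^2X\to PX$. Forcing. For $\phi\colon Z\to\Omega$ and $a\colon W\to Z$, $W\Vdash\phi(a)$ means $\phi\circ a=\top_W$. For $\psi\colon Z\times Y\to\Omega$, $\forall y\,\psi\colon Z\to\Omega$ is the transpose $Z\to PY$ of $\psi$ followed by $\forall_Y\colon PY\to\Omega$, the internal right adjoint of the inverse image $\Omega\cong P1\to PY$ along $Y\to 1$. Equivalently, $W\Vdash\forall y\,\psi(a,y)$ iff $V\Vdash\psi(ap,b)$ for all $p\colon V\to W$ and $b\colon V\to Y$. *)

(* Defs.v *)
From Stdlib Require Import Setoid.

Set Implicit Arguments.
Unset Strict Implicit.
Unset Printing Implicit Defensive.

Declare Scope topos_scope.
Delimit Scope topos_scope with topos.
Local Open Scope topos_scope.

(** * Elementary toposes *)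

Record category := Category {
  Ob :> Type;
  Hom : Ob -> Ob -> Type;
  idm : forall A : Ob, Hom A A;
  comp : forall A B C : Ob, Hom B C -> Hom A B -> Hom A C;
  comp_idl : forall (A B : Ob) (f : Hom A B), comp (idm B) f = f;
  comp_idr : forall (A B : Ob) (f : Hom A B), comp f (idm A) = f;
  comp_assoc : forall (A B C D : Ob) (h : Hom C D) (g : Hom B C) (f : Hom A B),
    comp h (comp g f) = comp (comp h g) f
}.
Arguments Hom {c} A B.
Arguments idm {c} A.
Arguments comp {c A B C} g f.

Notation "g ∘ f" := (comp g f) (at level 40, left associativity) : topos_scope.

Definition mono {C : category} {A B : C} (m : Hom A B) : Prop :=
  forall (W : C) (f g : Hom W A), m ∘ f = m ∘ g -> f = g.

Definition is_pullback {C : category} {D A B Z : C}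
    (p : Hom D A) (q : Hom D B) (f : Hom A Z) (g : Hom B Z) : Prop :=
  f ∘ p = g ∘ q /\
  forall (W : C) (u : Hom W A) (v : Hom W B), f ∘ u = g ∘ v ->
    exists! h : Hom W D, p ∘ h = u /\ q ∘ h = v.

(* Finite limits, as a terminal object, binary products and equalizers. *)
Record lex_category := LexCategory {
  lex_cat :> category;
  one : lex_cat;
  bang : forall A : lex_cat, Hom A one;
  bang_uniq : forall (A : lex_cat) (f : Hom A one), f = bang A;
  bprod : lex_cat -> lex_cat -> lex_cat;
  pr1 : forall A B : lex_cat, Hom (bprod A B) A;
  pr2 : forall A B : lex_cat, Hom (bprod A B) B;
  pairm : forall W A B : lex_cat, Hom W A -> Hom W B -> Hom W (bprod A B);
  pr1_pairm : forall (W A B : lex_cat) (f : Hom W A) (g : Hom W B),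
    pr1 A B ∘ pairm f g = f;
  pr2_pairm : forall (W A B : lex_cat) (f : Hom W A) (g : Hom W B),
    pr2 A B ∘ pairm f g = g;
  pairm_uniq : forall (W A B : lex_cat) (h : Hom W (bprod A B)),
    h = pairm (pr1 A B ∘ h) (pr2 A B ∘ h);
  eqz : forall A B : lex_cat, Hom A B -> Hom A B -> lex_cat;
  eqz_map : forall (A B : lex_cat) (f g : Hom A B), Hom (eqz f g) A;
  eqz_eq : forall (A B : lex_cat) (f g : Hom A B),
    f ∘ eqz_map f g = g ∘ eqz_map f g;
  eqz_univ : forall (A B : lex_cat) (f g : Hom A B) (W : lex_cat) (u : Hom W A),
    f ∘ u = g ∘ u -> exists! h : Hom W (eqz f g), eqz_map f g ∘ h = u
}.
Arguments one {l}.
Arguments bang {l} A.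
Arguments bprod {l} A B.
Arguments pr1 {l A B}.
Arguments pr2 {l A B}.
Arguments pairm {l W A B} f g.
Arguments eqz {l A B} f g.
Arguments eqz_map {l A B} f g.

Notation "A × B" := (bprod A B) (at level 40, left associativity) : topos_scope.
Notation "⟨ f , g ⟩" := (pairm f g) (at level 0, format "⟨ f ,  g ⟩") : topos_scope.

Definition prodm {C : lex_category} {A B A' B' : C}
    (f : Hom A A') (g : Hom B B') : Hom (A × B) (A' × B') :=
  ⟨f ∘ pr1, g ∘ pr2⟩.

Definition swap {C : lex_category} {A B : C} : Hom (A × B) (B × A) := ⟨pr2, pr1⟩.

Record topos := Topos {
  topos_lex :> lex_category;
  Omega : topos_lex;
  truth : Hom one Omega;
  char : forall (A B : topos_lex) (m : Hom A B), mono m -> Hom B Omega;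
  char_pullback : forall (A B : topos_lex) (m : Hom A B) (Hm : mono m),
    is_pullback m (bang A) (char Hm) truth;
  char_uniq : forall (A B : topos_lex) (m : Hom A B) (Hm : mono m)
      (c : Hom B Omega),
    is_pullback m (bang A) c truth -> c = char Hm;
  Pow : topos_lex -> topos_lex;
  mem : forall X : topos_lex, Hom (X × Pow X) Omega;
  transpose : forall X Y : topos_lex, Hom (X × Y) Omega -> Hom Y (Pow X);
  mem_transpose : forall (X Y : topos_lex) (f : Hom (X × Y) Omega),
    mem X ∘ prodm (idm X) (transpose f) = f;
  transpose_uniq : forall (X Y : topos_lex) (f : Hom (X × Y) Omega)
      (g : Hom Y (Pow X)),
    mem X ∘ prodm (idm X) g = f -> g = transpose f
}.
Arguments Omega {t}.
Arguments truth {t}.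
Arguments char {t A B m} Hm.
Arguments Pow {t} X.
Arguments mem {t} X.
Arguments transpose {t X Y} f.

Definition true_ {E : topos} (W : E) : Hom W Omega := truth ∘ bang W.

Definition forces {E : topos} {W Z : E} (phi : Hom Z Omega) (a : Hom W Z) : Prop :=
  phi ∘ a = true_ W.

Notation "a ⊩ phi" := (forces phi a) (at level 70, no associativity) : topos_scope.

Definition elem {E : topos} {W X : E} (x : Hom W X) (s : Hom W (Pow X)) :
  Hom W Omega := mem X ∘ ⟨x, s⟩.

Notation "x ∈ s" := (elem x s) (at level 50, no associativity) : topos_scope.

Definition Pmap {E : topos} {A B : E} (f : Hom A B) : Hom (Pow B) (Pow A) :=
  transpose (mem B ∘ prodm f (idm (Pow B))).

(** * Generalities on products and equalizers *)

Lemma pairm_comp {C : lex_category} (V W A B : C) (f : Hom W A) (g : Hom W B)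
    (p : Hom V W) : ⟨f, g⟩ ∘ p = ⟨f ∘ p, g ∘ p⟩.
Proof.
rewrite (pairm_uniq (⟨f, g⟩ ∘ p)), !comp_assoc, pr1_pairm, pr2_pairm.
reflexivity.
Qed.

Lemma pairm_inj {C : lex_category} (W A B : C) (f f' : Hom W A) (g g' : Hom W B) :
  ⟨f, g⟩ = ⟨f', g'⟩ -> f = f' /\ g = g'.
Proof.
intros H; split.
- rewrite <- (pr1_pairm f g), H; apply pr1_pairm.
- rewrite <- (pr2_pairm f g), H; apply pr2_pairm.
Qed.

Lemma eqz_mono {C : lex_category} (A B : C) (f g : Hom A B) : mono (eqz_map f g).
Proof.
intros W u v H.
destruct (@eqz_univ C A B f g W (eqz_map f g ∘ u)) as [h [_ Hh]].
- rewrite !comp_assoc, eqz_eq; reflexivity.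
- rewrite <- (Hh u eq_refl); apply Hh; symmetry; exact H.
Qed.

Lemma point_mono {C : lex_category} (A : C) (p : Hom one A) : mono p.
Proof. intros W f g _; rewrite (bang_uniq f); symmetry; apply bang_uniq. Qed.

Lemma swap_mono {C : lex_category} (R A B : C) (m : Hom R (A × B)) :
  mono m -> mono (swap ∘ m).
Proof.
intros Hm W f g H; apply Hm.
assert (K : swap ∘ (swap ∘ (m ∘ f)) = swap ∘ (swap ∘ (m ∘ g)))
  by (rewrite (comp_assoc _ m f), (comp_assoc _ m g), H; reflexivity).
revert K; unfold swap; rewrite !pairm_comp, !pr2_pairm, !pr1_pairm.
rewrite <- !pairm_uniq; exact (fun K => K).
Qed.

(** * Internal order structure of [Omega] and of power objects *)

(* The order of an internal meet-semilattice, as a subobject of [L × L]. *)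
Definition ord_map {E : topos} {L : E} (meet : Hom (L × L) L) :
  Hom (eqz meet pr1) (L × L) := eqz_map meet pr1.

Definition ord_char {E : topos} {L : E} (meet : Hom (L × L) L) :
  Hom (L × L) Omega := char (eqz_mono (f := meet) (g := pr1)).

Definition le_elt {E : topos} {L : E} (meet : Hom (L × L) L) {W : E}
    (u v : Hom W L) : Prop :=
  exists h : Hom W (eqz meet pr1), ord_map meet ∘ h = ⟨u, v⟩.

Definition meet_Omega {E : topos} : Hom (Omega × Omega) (Omega (t := E)) :=
  char (point_mono (p := ⟨truth, truth⟩)).

(* Pointwise meet: for [s t : W -> Pow X], [x ∈ s ∧ t] is [(x ∈ s) ∧ (x ∈ t)]. *)
Definition meet_Pow {E : topos} (X : E) : Hom (Pow X × Pow X) (Pow X) :=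
  transpose (meet_Omega ∘ ⟨pr1 ∈ (pr1 ∘ pr2), pr1 ∈ (pr2 ∘ pr2)⟩).

Definition is_heyting_imp {E : topos} {L : E} (meet imp : Hom (L × L) L) : Prop :=
  forall (W : E) (p q r : Hom W L),
    le_elt meet (meet ∘ ⟨p, q⟩) r <-> le_elt meet p (imp ∘ ⟨q, r⟩).

(* Internal adjunction [f ⊣ g] between internal posets, on generalized elements. *)
Definition internal_adjoint {E : topos} {L M : E}
    (meetL : Hom (L × L) L) (meetM : Hom (M × M) M)
    (f : Hom L M) (g : Hom M L) : Prop :=
  forall (W : E) (u : Hom W L) (v : Hom W M),
    le_elt meetM (f ∘ u) v <-> le_elt meetL u (g ∘ v).

(* Inverse image along [Y -> 1], precomposed with the isomorphism [Omega ≅ Pow 1]. *)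
Definition const_Pow {E : topos} (Y : E) : Hom Omega (Pow Y) :=
  Pmap (bang Y) ∘ transpose (X := one) pr2.

Section Existence.
Variable E : topos.

Lemma le_eltE (L : E) (meet : Hom (L × L) L) (W : E) (u v : Hom W L) :
  le_elt meet u v <-> meet ∘ ⟨u, v⟩ = u.
Proof.
split.
- intros [h Hh].
  rewrite <- Hh; unfold ord_map; rewrite comp_assoc, eqz_eq, <- comp_assoc.
  fold (ord_map meet); rewrite Hh; apply pr1_pairm.
- intros H.
  destruct (@eqz_univ E _ _ meet pr1 W ⟨u, v⟩) as [h [Hh _]].
  + rewrite pr1_pairm; exact H.
  + exists h; exact Hh.
Qed.

Lemma true_comp (V W : E) (p : Hom V W) : true_ W ∘ p = true_ V.
Proof.
unfold true_; rewrite <- comp_assoc; f_equal; apply bang_uniq.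
Qed.

Lemma forces_char (A B W : E) (m : Hom A B) (Hm : mono m) (b : Hom W B) :
  b ⊩ char Hm <-> exists h : Hom W A, m ∘ h = b.
Proof.
destruct (char_pullback Hm) as [Hc Hu]; split.
- intros Hb; destruct (Hu W b (bang W) Hb) as [h [[H _] _]].
  exists h; exact H.
- intros [h <-]; unfold forces; rewrite comp_assoc, Hc, <- comp_assoc.
  rewrite (bang_uniq (bang A ∘ h)); reflexivity.
Qed.

Lemma Omega_ext (Z : E) (u v : Hom Z Omega) :
  (forall (V : E) (b : Hom V Z), b ⊩ u <-> b ⊩ v) -> u = v.
Proof.
intros H.
set (m := eqz_map u (true_ Z)); pose proof (eqz_mono (f := u) (g := true_ Z)) as Hm.
fold m in Hm.
assert (Hum : m ⊩ u).
{ unfold forces; unfold m at 1; rewrite eqz_eq; fold m; apply true_comp. }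
assert (P : forall w : Hom Z Omega,
  (forall (V : E) (b : Hom V Z), b ⊩ u <-> b ⊩ w) ->
  is_pullback m (bang _) w truth).
{ intros w Hw; split.
  - exact (proj1 (Hw _ m) Hum).
  - intros W a c Hac.
    assert (Ha : a ⊩ u).
    { apply Hw; unfold forces; rewrite Hac, (bang_uniq c); reflexivity. }
    destruct (@eqz_univ E _ _ u (true_ Z) W a) as [h [Hh Hu]].
    + rewrite true_comp; exact Ha.
    + exists h; split.
      * split; [exact Hh|].
        rewrite (bang_uniq c); apply bang_uniq.
      * intros h' [Hh' _]; exact (Hu h' Hh'). }
rewrite (char_uniq Hm (P u (fun _ _ => conj (fun x => x) (fun x => x)))).
symmetry; apply char_uniq; exact (P v H).
Qed.

Lemma forces_meet (W V : E) (p q : Hom W Omega) (b : Hom V W) :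
  b ⊩ (meet_Omega ∘ ⟨p, q⟩) <-> b ⊩ p /\ b ⊩ q.
Proof.
assert (X : b ⊩ (meet_Omega ∘ ⟨p, q⟩) <-> ⟨p ∘ b, q ∘ b⟩ ⊩ meet_Omega).
{ unfold forces; rewrite <- comp_assoc, pairm_comp; tauto. }
rewrite X; unfold meet_Omega; rewrite forces_char; split.
- intros [h Hh]; rewrite pairm_comp in Hh; apply pairm_inj in Hh.
  rewrite (bang_uniq h) in Hh; destruct Hh as [H1 H2].
  split; symmetry; assumption.
- intros [Hp Hq]; exists (bang V); rewrite pairm_comp, Hp, Hq; reflexivity.
Qed.

Lemma le_OmegaE (W : E) (u v : Hom W Omega) :
  le_elt meet_Omega u v <->
  forall (V : E) (b : Hom V W), b ⊩ u -> b ⊩ v.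
Proof.
rewrite le_eltE; split.
- intros H V b Hb; rewrite <- H in Hb.
  apply forces_meet in Hb; tauto.
- intros H; apply Omega_ext; intros V b; rewrite forces_meet.
  specialize (H V b); tauto.
Qed.

Lemma forces_ord_char (L : E) (meet : Hom (L × L) L) (W : E) (u v : Hom W L) :
  ⟨u, v⟩ ⊩ ord_char meet <-> le_elt meet u v.
Proof. unfold ord_char; rewrite forces_char; reflexivity. Qed.

Lemma heyting_imp_Omega :
  {imp : Hom (Omega × Omega) (Omega (t := E)) | is_heyting_imp meet_Omega imp}.
Proof.
exists (ord_char meet_Omega); intros W p q r; rewrite !le_OmegaE.
assert (X : forall (V : E) (b : Hom V W),
  b ⊩ (ord_char meet_Omega ∘ ⟨q, r⟩) <->
  le_elt meet_Omega (q ∘ b) (r ∘ b)).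
{ intros V b; rewrite <- forces_ord_char; unfold forces.
  rewrite <- comp_assoc, pairm_comp; tauto. }
split.
- intros H V b Hb; apply X, le_OmegaE; intros V' b' Hq.
  unfold forces; rewrite <- comp_assoc; apply H, forces_meet; split.
  + unfold forces; rewrite comp_assoc, Hb; apply true_comp.
  + unfold forces; rewrite comp_assoc; exact Hq.
- intros H V b Hb; apply forces_meet in Hb; destruct Hb as [Hp Hq].
  specialize (H V b Hp); apply X in H.
  rewrite le_OmegaE in H.
  specialize (H V (idm V)); unfold forces in *; rewrite !comp_idr in H; auto.
Qed.

Lemma elem_comp (V W X : E) (x : Hom W X) (s : Hom W (Pow X)) (p : Hom V W) :
  (x ∈ s) ∘ p = (x ∘ p) ∈ (s ∘ p).
Proof. unfold elem; rewrite <- comp_assoc, pairm_comp; reflexivity. Qed.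

Lemma elem_transpose (W X Y : E) (f : Hom (X × Y) Omega)
    (x : Hom W X) (y : Hom W Y) : x ∈ (transpose f ∘ y) = f ∘ ⟨x, y⟩.
Proof.
rewrite <- (mem_transpose f) at 2; unfold elem, prodm.
rewrite <- comp_assoc, pairm_comp, <- !comp_assoc, pr1_pairm, pr2_pairm, comp_idl.
reflexivity.
Qed.

Lemma Pow_ext (W X : E) (s t : Hom W (Pow X)) :
  (forall (V : E) (p : Hom V W) (x : Hom V X), x ∈ (s ∘ p) = x ∈ (t ∘ p)) ->
  s = t.
Proof.
intros H; rewrite (transpose_uniq (g := t) eq_refl); apply transpose_uniq.
specialize (H _ (pr2 : Hom (X × W) W) pr1).
unfold elem in H; unfold prodm; rewrite comp_idl; exact H.
Qed.

Lemma elem_Pmap (W A B : E) (f : Hom A B) (a : Hom W A) (s : Hom W (Pow B)) :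
  a ∈ (Pmap f ∘ s) = (f ∘ a) ∈ s.
Proof.
unfold Pmap; rewrite elem_transpose; unfold elem, prodm.
rewrite <- comp_assoc, pairm_comp, <- !comp_assoc, pr1_pairm, pr2_pairm, comp_idl.
reflexivity.
Qed.

Lemma le_PowE (X W : E) (s t : Hom W (Pow X)) :
  le_elt (meet_Pow X) s t <->
  forall (V : E) (p : Hom V W) (x : Hom V X),
    x ∈ (s ∘ p) = true_ V -> x ∈ (t ∘ p) = true_ V.
Proof.
assert (M : forall (V : E) (p : Hom V W) (x : Hom V X),
  x ∈ (meet_Pow X ∘ ⟨s, t⟩ ∘ p) =
  meet_Omega ∘ ⟨x ∈ (s ∘ p), x ∈ (t ∘ p)⟩).
{ intros V p x; unfold meet_Pow; rewrite <- comp_assoc, elem_transpose.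
  rewrite <- comp_assoc, !pairm_comp, !elem_comp, <- !comp_assoc.
  rewrite pr1_pairm, pr2_pairm, pr1_pairm, pr2_pairm; reflexivity. }
rewrite le_eltE; split.
- intros H V p x Hx.
  assert (K := M V p x); rewrite H in K.
  assert (F : idm V ⊩ (meet_Omega ∘ ⟨x ∈ (s ∘ p), x ∈ (t ∘ p)⟩)).
  { rewrite <- K; unfold forces; rewrite comp_idr; exact Hx. }
  apply forces_meet in F; destruct F as [_ F]; unfold forces in F.
  rewrite comp_idr in F; exact F.
- intros H; apply Pow_ext; intros V p x; rewrite M.
  apply Omega_ext; intros V' b; rewrite forces_meet; unfold forces.
  rewrite !elem_comp, <- !comp_assoc; split; [tauto|].
  intros F; split; [exact F|apply H; exact F].
Qed.

Lemma forall_Pow (Y : E) :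
  {all : Hom (Pow Y) Omega |
    internal_adjoint meet_Omega (meet_Pow Y) (const_Pow Y) all}.
Proof.
set (full := transpose (true_ (Y × one)) : Hom one (Pow Y)).
exists (char (point_mono (p := full))); intros W u v.
assert (C : forall (V : E) (p : Hom V W) (y : Hom V Y),
  y ∈ (const_Pow Y ∘ u ∘ p) = u ∘ p).
{ intros V p y; unfold const_Pow; rewrite <- !comp_assoc, elem_Pmap.
  rewrite elem_transpose; apply pr2_pairm. }
assert (F : forall (V : E) (y : Hom V Y) (k : Hom V one),
  y ∈ (full ∘ k) = true_ V).
{ intros V y k; unfold full; rewrite elem_transpose; apply true_comp. }
assert (A : forall (V : E) (p : Hom V W),
  p ⊩ (char (point_mono (p := full)) ∘ v) <->
  forall (V' : E) (q : Hom V' V) (y : Hom V' Y),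
    y ∈ (v ∘ p ∘ q) = true_ V').
{ intros V p.
  assert (X : p ⊩ (char (point_mono (p := full)) ∘ v) <->
              v ∘ p ⊩ char (point_mono (p := full))).
  { unfold forces; rewrite comp_assoc; tauto. }
  rewrite X, forces_char; split.
  - intros [h <-] V' q y; rewrite <- comp_assoc, F; reflexivity.
  - intros H; exists (bang V); apply Pow_ext; intros V' q y.
    rewrite <- comp_assoc, F; symmetry; apply H. }
rewrite le_PowE, le_OmegaE; split.
- intros H V p Hp; apply A; intros V' q y.
  rewrite <- comp_assoc; apply H; rewrite C, comp_assoc, Hp.
  apply true_comp.
- intros H V p y Hy; rewrite C in Hy.
  specialize (proj1 (A V p) (H V p Hy) V (idm V) y); rewrite comp_idr; auto.
Qed.

End Existence.

(* Both operations are determined by their universal property; the existence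
   proofs are opaque, so nothing else about the witnesses is available. *)
Definition imp_Omega {E : topos} : Hom (Omega × Omega) (Omega (t := E)) :=
  proj1_sig (heyting_imp_Omega E).

Definition all_Pow {E : topos} (Y : E) : Hom (Pow Y) Omega :=
  proj1_sig (forall_Pow Y).

Notation "p ⇒ q" := (imp_Omega ∘ ⟨p, q⟩) (at level 60, right associativity) :
  topos_scope.

(* The context swaps the factors because the transpose is taken in the first one. *)
Definition all_form {E : topos} {Z Y : E} (psi : Hom (Z × Y) Omega) :
  Hom Z Omega := all_Pow Y ∘ transpose (psi ∘ swap).

(** * Relations and the interior operator *)

Record rel_on {E : topos} (X : E) := RelOn {
  rel_ob : E;
  rel_map : Hom rel_ob (X × X);
  rel_mono : mono rel_map
}.
Arguments rel_map {E X} r.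
Arguments rel_mono {E X} r.

Section Interior.
Variables (E : topos) (X : E) (r : rel_on X).

Definition le_rel : Hom (X × X) Omega := char (rel_mono r).

Definition dagger : rel_on X := RelOn (swap_mono (rel_mono r)).

End Interior.

Definition up {E : topos} {X : E} (r : rel_on X) : Hom X (Pow X) :=
  transpose (le_rel (dagger r)).

Definition down {E : topos} (X : E) : Hom (Pow X) (Pow (Pow X)) :=
  transpose (ord_char (meet_Pow X)).

Definition interior {E : topos} {X : E} (r : rel_on X) : Hom (Pow X) (Pow X) :=
  Pmap (up r) ∘ down X.

(* Main.v *)
(* Unfolding the transposes, [a ∈ int(s)] is the internal inequality [up a <= s] in
   [Pow X]; on generalized elements this says that [a <= y] forces [y ∈ s] at every
   later stage, which is also the Kripke-Joyal reading of the quantified implication. *)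
Require Import Defs.
Local Open Scope topos_scope.

Lemma forces_comp {E : topos} {W Z V : E} (phi : Hom Z Omega) (a : Hom W Z)
    (b : Hom V W) : b ⊩ (phi ∘ a) <-> a ∘ b ⊩ phi.
Proof. unfold forces; rewrite comp_assoc; reflexivity. Qed.

(** Since [true_ W] is the top element at stage [W], forcing becomes an inequality, the form in
    which the adjunctions characterizing [imp_Omega] and [all_Pow] apply. *)
Lemma true_le_Omega {E : topos} {W : E} (u : Hom W Omega) :
  le_elt meet_Omega (true_ W) u <-> u = true_ W.
Proof.
rewrite le_OmegaE; split.
- intros H; rewrite <- (comp_idr u); exact (H W (idm W) (true_comp (idm W))).
- intros -> V b Hb; exact Hb.
Qed.

(** Heyting adjunction with [true_ W] as left conjunct: the meet of truth and [p ∘ a] is forced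
    exactly when [p ∘ a] is. *)
Lemma forces_imp {E : topos} {W Z : E} (p q : Hom Z Omega) (a : Hom W Z) :
  a ⊩ (p ⇒ q) <->
  forall (V : E) (b : Hom V W), a ∘ b ⊩ p -> a ∘ b ⊩ q.
Proof.
unfold forces at 1; rewrite <- comp_assoc, pairm_comp, <- true_le_Omega.
rewrite <- (proj2_sig (heyting_imp_Omega E) W _ _ _), le_OmegaE.
split; intros H V b.
- rewrite <- !forces_comp; intros Hb; apply H, forces_meet.
  split; [apply true_comp | exact Hb].
- rewrite forces_meet, !forces_comp; intros [_ Hb]; auto.
Qed.

Lemma elem_const_Pow {E : topos} {W Y : E} (u : Hom W Omega) (y : Hom W Y) :
  y ∈ (const_Pow Y ∘ u) = u.
Proof.
unfold const_Pow; rewrite <- comp_assoc, elem_Pmap, elem_transpose.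
apply pr2_pairm.
Qed.

(** The adjunction of [const_Pow] and [all_Pow], taken at truth: the constant family at truth
    contains every [y], so it lies below the transpose of [psi] exactly when [psi] holds at all
    later stages. *)
Lemma forces_all_form {E : topos} {W Z Y : E} (psi : Hom (Z × Y) Omega)
    (a : Hom W Z) :
  a ⊩ all_form psi <->
  forall (V : E) (p : Hom V W) (y : Hom V Y), ⟨a ∘ p, y⟩ ⊩ psi.
Proof.
unfold forces at 1, all_form; rewrite <- comp_assoc, <- true_le_Omega.
rewrite <- (proj2_sig (forall_Pow Y) W _ _), le_PowE.
assert (T : forall (V : E) (p : Hom V W) (y : Hom V Y),
  y ∈ (transpose (psi ∘ swap) ∘ a ∘ p) = psi ∘ ⟨a ∘ p, y⟩).
{ intros V p y; rewrite <- comp_assoc, elem_transpose; unfold swap.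
  rewrite <- comp_assoc, pairm_comp, pr1_pairm, pr2_pairm; reflexivity. }
split; intros H V p y.
- unfold forces; rewrite <- T; apply H.
  rewrite <- comp_assoc, elem_const_Pow; apply true_comp.
- intros _; rewrite T; apply H.
Qed.

(** Both sides are forced at the same stages, because [swap] is an involution: a pair factors
    through [rel_map r] iff its reversal factors through the swapped map. *)
Lemma le_rel_dagger {E : topos} {X W : E} (r : rel_on X) (x y : Hom W X) :
  le_rel (dagger r) ∘ ⟨y, x⟩ = le_rel r ∘ ⟨x, y⟩.
Proof.
apply Omega_ext; intros V b; rewrite !forces_comp, !pairm_comp.
unfold le_rel; rewrite !forces_char; unfold dagger; cbn.
assert (S : forall (A B : E) (f : Hom V (A × B)) u v,
  swap ∘ f = ⟨v, u⟩ <-> f = ⟨u, v⟩).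
{ intros A B f u v; unfold swap; rewrite pairm_comp; split.
  - intros H; apply pairm_inj in H; destruct H as [<- <-]; apply pairm_uniq.
  - intros ->; rewrite pr1_pairm, pr2_pairm; reflexivity. }
split; intros [h Hh]; exists h.
- apply S; rewrite comp_assoc; exact Hh.
- rewrite <- comp_assoc; apply S; exact Hh.
Qed.

Lemma elem_up {E : topos} {X W : E} (r : rel_on X) (x y : Hom W X) :
  y ∈ (up r ∘ x) = le_rel r ∘ ⟨x, y⟩.
Proof. unfold up; rewrite elem_transpose; apply le_rel_dagger. Qed.

Lemma elem_interior {E : topos} {X W : E} (r : rel_on X) (a : Hom W X)
    (s : Hom W (Pow X)) :
  a ∈ (interior r ∘ s) = true_ W <-> le_elt (meet_Pow X) (up r ∘ a) s.
Proof.
unfold interior; rewrite <- comp_assoc, elem_Pmap; unfold down.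
rewrite elem_transpose; apply forces_ord_char.
Qed.

Theorem proposition3p8 (E : topos) (X : E) (r : rel_on X) (W : E)
    (a : Hom W X) (s : Hom W (Pow X)) :
  ⟨a, s⟩ ⊩ (pr1 ∈ (interior r ∘ pr2) : Hom (X × Pow X) Omega)
  <->
  ⟨a, s⟩ ⊩ all_form (Z := X × Pow X) (Y := X)
             ((le_rel r ∘ ⟨pr1 ∘ pr1, pr2⟩) ⇒ (pr2 ∈ (pr2 ∘ pr1))).
Proof.
assert (L : ⟨a, s⟩ ⊩ (pr1 ∈ (interior r ∘ pr2) : Hom (X × Pow X) Omega) <->
  forall (V : E) (p : Hom V W) (y : Hom V X),
    le_rel r ∘ ⟨a ∘ p, y⟩ = true_ V -> y ∈ (s ∘ p) = true_ V).
{ unfold forces; rewrite elem_comp, <- comp_assoc, pr1_pairm, pr2_pairm.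
  rewrite elem_interior, le_PowE.
  split; intros H V p y Hy; apply H; revert Hy;
    rewrite <- comp_assoc, elem_up; exact (fun h => h). }
assert (P : forall (V : E) (p : Hom V W) (y : Hom V X),
  (⟨⟨a, s⟩ ∘ p, y⟩ ⊩ (le_rel r ∘ ⟨pr1 ∘ pr1, pr2⟩) <->
     le_rel r ∘ ⟨a ∘ p, y⟩ = true_ V) /\
  (⟨⟨a, s⟩ ∘ p, y⟩ ⊩ (pr2 ∈ (pr2 ∘ pr1)) <-> y ∈ (s ∘ p) = true_ V)).
{ intros V p y; unfold forces.
  rewrite elem_comp, <- !comp_assoc, !pairm_comp, <- !comp_assoc.
  rewrite !pr1_pairm, !pr2_pairm; split; reflexivity. }
rewrite L, forces_all_form; split; intros H V p y.
(* The semantic condition is used at the later stage [p ∘ b] with the element [y ∘ b]. *)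
- apply forces_imp; intros V' b.
  rewrite pairm_comp, <- comp_assoc; intros Hr; apply P, H, P; exact Hr.
- intros Hr.
  (* The forced implication is evaluated at the identity of [V]. *)
  apply P; rewrite <- (comp_idr ⟨⟨a, s⟩ ∘ p, y⟩).
  apply (proj1 (forces_imp _ _ _) (H V p y)).
  rewrite comp_idr; apply P; exact Hr.
Qed.
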